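(* Let $W$ be a 1-planar graph of class $\mathcal C_1$. Then $|E(W)|\le 3.6\,|V(W)|-7.2$. Moreover, this bound is tight: there exists a 1-planar graph $W$ of class $\mathcal C_1$ with $|E(W)|= 3.6\,|V(W)|-7.2$.
   Context: All graphs are finite, simple and undirected. A drawing of a graph in the plane is 1-planar if each edge is crossed at most once; a graph is 1-planar if it has a 1-planar drawing. In 1-planar drawings it is assumed that adjacent edges never cross and no edge crosses itself, so each crossing involves two edges with four distinct endvertices. For a 1-planar drawing $D$, the associated plane graph $D^\times$ is obtained by turning each crossing into a new vertex of degree four, called a false vertex; for a false vertex $c$, $N_{D^\times}(c)$ denotes its set of (four) neighbours in $D^\times$. A 1-planar graph is of class $\mathcal C_0$ if it has a 1-planar drawing $D$ such that $|N_{D^\times}(c_1)\cap N_{D^\times}(c_2)|=0$ for any two distinct false vertices $c_1,c_2$. For $i\in\{1,2\}$, a 1-planar graph is of class $\mathcal C_i$ if it is not of class $\mathcal C_k$ for any $k<i$ and it has a 1-planar drawing $D$ with $|N_{D^\times}(c_1)\cap N_{D^\times}(c_2)|\le i$ for any two distinct false vertices $c_1,c_2$. *)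

(* Defs.v *)
From mathcomp Require Import all_boot.
Set Implicit Arguments. Unset Strict Implicit. Unset Printing Implicit Defensive.

Section OnePlanar.
Variables (V : finType) (adj : rel V).

Definition edge_set : {set {set V}} :=
  [set E : {set V} | [exists x, exists y, adj x y && (E == [set x; y])]].
Definition nedges : nat := #|edge_set|.

Section Drawing.
(* A set K of crossings; crossing k is the crossing of edge {ka k, kb k}
   with edge {kc k, kd k}. *)
Variables (K : finType) (ka kb kc kd : K -> V).

Definition cr_edge (k : K) (s : bool) : {set V} :=
  if s then [set ka k; kb k] else [set kc k; kd k].

Definition cr_nbhd (k : K) : {set V} := [set ka k; kb k; kc k; kd k].

Definition valid_crossings : Prop :=
  (forall k, [/\ uniq [:: ka k; kb k; kc k; kd k],
                 adj (ka k) (kb k) & adj (kc k) (kd k)]) /\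
  (* every edge is crossed at most once *)
  injective (fun p : K * bool => cr_edge p.1 p.2).

Definition crossed (x y : V) : bool :=
  [exists p : K * bool, cr_edge p.1 p.2 == [set x; y]].

(* the planarization D^x : real vertices inl x, false vertices inr k *)
Definition padj (u w : V + K) : bool :=
  match u, w with
  | inl x, inl y => adj x y && ~~ crossed x y
  | inl x, inr k => x \in cr_nbhd k
  | inr k, inl x => x \in cr_nbhd k
  | inr _, inr _ => false
  end.

(* rotation system: rot u v = neighbour of u following v cyclically *)
Definition rotation_system (rot : V + K -> V + K -> V + K) : Prop :=
  [/\ forall u v, padj u v -> padj u (rot u v),
      forall u v w, padj u v -> padj u w -> rot u v = rot u w -> v = w
    & forall u v w, padj u v -> padj u w -> exists n, iter n (rot u) v = w].

(* at a false vertex the two crossing edges alternate (genuine crossing) *)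
Definition alternating (rot : V + K -> V + K -> V + K) : Prop :=
  forall k, [/\ rot (inr k) (inl (ka k)) != inl (kb k),
                rot (inr k) (inl (kb k)) != inl (ka k),
                rot (inr k) (inl (kc k)) != inl (kd k) &
                rot (inr k) (inl (kd k)) != inl (kc k)].

Definition darts : {set (V + K) * (V + K)} := [set p | padj p.1 p.2].

Definition face_map (rot : V + K -> V + K -> V + K)
  (p : (V + K) * (V + K)) : (V + K) * (V + K) :=
  if padj p.1 p.2 then (p.2, rot p.2 p.1) else p.

Definition nfaces rot : nat :=
  #|[set [set q | fconnect (face_map rot) p q] | p in darts]|.

Definition ncomp : nat := #|[set [set w | connect padj u w] | u : V + K]|.
Definition ncomp_nontriv : nat :=
  #|[set [set w | connect padj u w] | u in [set u : V + K | [exists w, padj u w]]]|.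

(* Euler's formula V - E + F = #components + #nontrivial components,
   i.e. every component of the combinatorial map has genus 0 *)
Definition genus0 rot : Prop :=
  2 * #|{: V + K}| + 2 * nfaces rot = #|darts| + 2 * ncomp + 2 * ncomp_nontriv.

Definition one_planar_drawing : Prop :=
  valid_crossings /\
  exists rot, [/\ rotation_system rot, alternating rot & genus0 rot].

End Drawing.

Definition has_drawing_le (i : nat) : Prop :=
  exists (K : finType) (ka kb kc kd : K -> V),
    one_planar_drawing ka kb kc kd /\
    forall k1 k2 : K, k1 != k2 ->
      #|cr_nbhd ka kb kc kd k1 :&: cr_nbhd ka kb kc kd k2| <= i.

Definition classC0 : Prop := has_drawing_le 0.
Definition classC1 : Prop := ~ classC0 /\ has_drawing_le 1.

End OnePlanar.

(* Main.v *)
Require Import Defs.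
From mathcomp Require Import all_boot zify.
Set Implicit Arguments. Unset Strict Implicit. Unset Printing Implicit Defensive.

(* The bound is a discharging over the faces of the planarization.  Let r and t
   be the numbers of real-real darts and of false vertices on a face, which then
   has length r + 2 t, and let c be the number of crossings.  The sums of r and
   of t over all faces are 2 |E| - 4 c and 4 c, so by Euler's formula it is
   enough that 13 r + 22 t >= 36 on average.  Only the triangles with one false
   vertex fail this, by 1, and each can take 1 through its unique real edge from
   the face on the other side: that face spares one unit per real edge, and it
   is not again a false triangle, for two of them on a common edge would belong
   to crossings sharing two endvertices.  (Faces of length 2 are isolated edges,
   and are paid for by the number of components.)

   For sharpness take the cuboctahedron with both diagonals drawn in each of its
   six squares: 12 vertices, 36 edges, 6 crossings.  It is not of class C_0, as
   there one would have 4 c <= 12, whereas |E| <= 3 * 12 - 5 + c. *)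

(** * Unordered pairs and double counting of edges *)

Lemma set2_eqE (V : finType) (a b x y : V) :
  ([set a; b] == [set x; y]) = ((a == x) && (b == y)) || ((a == y) && (b == x)).
Proof.
apply/eqP/idP => [E|]; last first.
  by case/orP=> /andP[/eqP-> /eqP->] //; rewrite setUC.
have : a \in [set x; y] by rewrite -E set21.
have : b \in [set x; y] by rewrite -E set22.
have : x \in [set a; b] by rewrite E set21.
have : y \in [set a; b] by rewrite E set22.
rewrite !inE ![x == _]eq_sym ![y == _]eq_sym.
by case: (a == x); case: (a == y); case: (b == x); case: (b == y).
Qed.

(** Handshake count: the fibre of an edge under [h] consists of its two orientations, distinct
    because there are no loops. *)
Lemma card_darts_edge_set (V : finType) (adj : rel V) :
  symmetric adj -> irreflexive adj ->
  #|[set p : V * V | adj p.1 p.2]| = 2 * nedges adj.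
Proof.
move=> adjC adjI; pose h (p : V * V) := [set p.1; p.2].
set D := [set p | _].
have -> : nedges adj = #|h @: D|.
  rewrite /nedges; congr #|pred_of_set _|; apply/setP => E; rewrite !inE.
  apply/existsP/imsetP => [[x /existsP[y /andP[xy /eqP->]]]|[[x y]]].
    by exists (x, y); rewrite ?inE.
  by rewrite inE => /= xy ->; exists x; apply/existsP; exists y; rewrite xy eqxx.
rewrite -sum1_card (partition_big_imset h) /= mulnC -sum_nat_const.
apply: eq_bigr => _ /imsetP[[x y] xyD ->]; rewrite sum1_card.
have xy : adj x y by rewrite inE in xyD.
have neq : x != y by apply: contraTneq xy => ->; rewrite adjI.
rewrite (@eq_card _ _ [set (x, y); (y, x)]) ?cards2 -?pair_eqE /= ?negb_and ?neq //.
move=> [a b]; rewrite !inE unfold_in /h /= set2_eqE -!pair_eqE /=.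
by rewrite andb_idl //; case/orP=> /andP[/eqP-> /eqP->]; rewrite // inE adjC.
Qed.

Lemma sumnD (I : finType) (A : {set I}) (F G : I -> nat) :
  \sum_(i in A) (F i + G i) = \sum_(i in A) F i + \sum_(i in A) G i.
Proof. exact: big_split. Qed.

Lemma sumnMr (I : finType) (A : {set I}) (c : nat) (F : I -> nat) :
  \sum_(i in A) c * F i = c * \sum_(i in A) F i.
Proof. by rewrite big_distrr. Qed.

(** * Counting the darts of the planarization *)

Section Drawing.
Variables (V : finType) (adj : rel V).
Hypotheses (adjC : symmetric adj) (adjI : irreflexive adj).
Variables (K : finType) (ka kb kc kd : K -> V).
Hypothesis valid : valid_crossings adj ka kb kc kd.

Local Notation e := (padj adj ka kb kc kd).
Local Notation D := (darts adj ka kb kc kd).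
Local Notation N := (cr_nbhd ka kb kc kd).
Local Notation crossedb := (crossed ka kb kc kd).

Definition is_false (u : V + K) := if u is inr _ then true else false.
Definition real_dart (p : (V + K) * (V + K)) := ~~ is_false p.1 && ~~ is_false p.2.

Lemma crossedC x y : crossedb x y = crossedb y x.
Proof. by rewrite /crossed setUC. Qed.

Lemma padjC : symmetric e.
Proof. by move=> [x|k] [y|l] //=; rewrite adjC crossedC. Qed.

Lemma padjI : irreflexive e.
Proof. by move=> [x|k] //=; rewrite adjI. Qed.

Lemma card_cr_nbhd k : #|N k| = 4.
Proof.
have [u _ _] := valid.1 k.
rewrite -[RHS](card_uniqP u); apply: eq_card => x.
by rewrite !inE !orbA.
Qed.

Lemma cr_edge_adj p : cr_edge ka kb kc kd p.1 p.2 \in edge_set adj.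
Proof.
have [_ ab cd] := valid.1 p.1; rewrite inE.
by case: p ab cd => k [] /= ab cd; apply/existsP;
  [exists (ka k)|exists (kc k)]; apply/existsP; [exists (kb k)|exists (kd k)];
  rewrite eqxx andbT.
Qed.

(** No edge is crossed twice, so [cr_edge] is injective on [K * bool] and the crossings remove
    exactly two edges each. *)
Lemma nedges_uncrossed :
  nedges adj = nedges (fun x y => adj x y && ~~ crossedb x y) + 2 * #|K|.
Proof.
set C := [set cr_edge ka kb kc kd p.1 p.2 | p : K * bool].
have cC : #|C| = 2 * #|K|.
  by rewrite card_imset ?card_prod ?card_bool 1?mulnC //; exact: valid.2.
rewrite /nedges -cC -(cardsID C (edge_set adj)) [LHS]addnC; congr addn.
  congr #|pred_of_set _|; apply/setP => E; rewrite 2!inE [in RHS]inE.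
  apply/andP/existsP => [[EC]|[x /existsP[y /andP[/andP[xy cxy] /eqP->]]]].
    case/existsP=> x /existsP[y /andP[xy /eqP def_E]].
    exists x; apply/existsP; exists y.
    rewrite xy def_E eqxx andbT; apply: contra EC => /existsP[p /eqP Ep].
    by apply/imsetP; exists p; rewrite // def_E -Ep.
  split; last by apply/existsP; exists x; apply/existsP; exists y; rewrite xy eqxx.
  by apply: contra cxy => /imsetP[p _ Ep]; apply/existsP; exists p; rewrite Ep.
congr #|pred_of_set _|; apply/setIidPr/subsetP => _ /imsetP[p _ ->].
exact: cr_edge_adj.
Qed.

Lemma card_false_darts : #|[set p in D | is_false p.1]| = 4 * #|K|.
Proof.
pose h (q : K * V) : (V + K) * (V + K) := (inr q.1, inl q.2).
have -> : [set p in D | is_false p.1] = h @: [set q | q.2 \in N q.1].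
  apply/setP => -[u v]; rewrite !inE /=; apply/idP/imsetP => [|[[k x]]].
    case: u v => [y|k] [x|l]; rewrite /= ?andbF // andbT => kx.
    by exists (k, x); rewrite 1?inE.
  by rewrite inE => kx [-> ->]; rewrite /= andbT.
rewrite card_imset => [|[k x] [l y] [-> ->] //].
rewrite -sum1dep_card -(pair_big_dep predT (fun k x => x \in N k) (fun _ _ => 1)) /=.
rewrite (eq_bigr (fun=> 4)) ?sum_nat_const 1?mulnC // => k _.
by rewrite sum1_card card_cr_nbhd.
Qed.

Lemma card_real_darts : #|[set p in D | real_dart p]| + 4 * #|K| = 2 * nedges adj.
Proof.
rewrite nedges_uncrossed mulnDr mulnA; congr (_ + _).
rewrite -card_darts_edge_set; first last.
- by move=> x; rewrite adjI.
- by move=> x y; rewrite adjC crossedC.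
pose h (p : V * V) : (V + K) * (V + K) := (inl p.1, inl p.2).
rewrite -(card_imset _ (_ : injective h)); last by move=> [? ?] [? ?] [-> ->].
congr #|pred_of_set _|; apply/setP => -[u v]; rewrite !inE /=.
apply/idP/imsetP => [|[[x y]]].
  case: u v => [x|k] [y|l]; rewrite /= ?andbF // andbT => xy.
  by exists (x, y); rewrite 1?inE.
by rewrite inE => xy [-> ->]; rewrite /= andbT.
Qed.

(** Four neighbours do not fit into a pair. This later prevents the rotation at a false vertex from
    closing up on one or two neighbours. *)
Lemma mem_cr_nbhd_other k (x y : V) : exists2 z, z \in N k & z \notin [set x; y].
Proof.
apply/subsetPn; apply/negP => /subset_leq_card.
by rewrite card_cr_nbhd cards2; case: (_ != _).
Qed.

(** * Faces as orbits of the face map *)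

Variable rot : V + K -> V + K -> V + K.
Hypothesis rotP : rotation_system adj ka kb kc kd rot.

Local Notation phi := (face_map adj ka kb kc kd rot).

Definition face p := [set q | fconnect phi p q].
Definition faces := [set face p | p in D].
Definition nreal (f : {set (V + K) * (V + K)}) := #|[set d in f | real_dart d]|.
(** Visits to false vertices are counted with multiplicity, one for each dart of the face that
    leaves such a vertex. *)
Definition nfalse (f : {set (V + K) * (V + K)}) := #|[set d in f | is_false d.1]|.

Lemma phiE p : p \in D -> phi p = (p.2, rot p.2 p.1).
Proof. by rewrite inE /face_map => ->. Qed.

Lemma phi_id p : p \notin D -> phi p = p.
Proof. by rewrite inE /face_map => /negbTE ->. Qed.

Lemma phi_darts p : (phi p \in D) = (p \in D).
Proof.
have [rotD _ _] := rotP.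
have [pD|pD] := boolP (p \in D); last by rewrite phi_id // (negbTE pD).
by rewrite phiE // inE rotD // padjC; rewrite inE in pD.
Qed.

(** Equal images have the same first entry, so both darts end at the same vertex; injectivity of the
    rotation there identifies their tails. *)
Lemma phi_inj : injective phi.
Proof.
have [_ rot_inj _] := rotP.
move=> p q E; have := phi_darts p; rewrite E phi_darts => /esym Dpq.
have [pD|pD] := boolP (p \in D); last by rewrite -(phi_id pD) E phi_id // -Dpq.
have qD : q \in D by rewrite -Dpq.
move: E; rewrite !phiE // => -[E2]; rewrite -E2 => E.
move: pD qD; rewrite !inE -E2 => pD qD.
rewrite [p]surjective_pairing [q]surjective_pairing -E2; congr pair.
by apply: rot_inj E; rewrite padjC.
Qed.

Lemma iter_phi_darts n p : (iter n phi p \in D) = (p \in D).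
Proof. by elim: n => //= n IH; rewrite phi_darts. Qed.

Lemma face_sub_darts p : p \in D -> face p \subset D.
Proof.
move=> pD; apply/subsetP => q; rewrite inE => /iter_findex <-.
by rewrite iter_phi_darts.
Qed.

Lemma face_refl p : p \in face p.
Proof. by rewrite inE. Qed.

Lemma face_eq p q : q \in face p -> face q = face p.
Proof.
rewrite inE => pq; apply/setP => z; rewrite !inE.
by rewrite (same_connect (fconnect_sym phi_inj) pq).
Qed.

Lemma facesP f d : f \in faces -> d \in f -> (f = face d) * (d \in D).
Proof.
case/imsetP=> p pD -> dp; split; first by rewrite (face_eq dp).
exact: (subsetP (face_sub_darts pD)).
Qed.

Lemma face_phi f d : f \in faces -> d \in f -> phi d \in f.
Proof. by move=> fF df; rewrite (facesP fF df) inE fconnect1. Qed.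

Lemma faces_partition : partition faces D.
Proof.
have -> : faces = equivalence_partition (fconnect phi) D.
  apply: eq_in_imset => p pD; apply/setP => q; rewrite !inE andbC.
  case pq: (fconnect _ _ _) => //=; symmetry.
  by have := subsetP (face_sub_darts pD) q; rewrite !inE pq => ->.
apply: equivalence_partitionP => x y z _ _ _; split => // xy.
exact: (same_connect (fconnect_sym phi_inj) xy).
Qed.

Lemma sum_faces (Q : pred ((V + K) * (V + K))) :
  \sum_(f in faces) #|[set d in f | Q d]| = #|[set d in D | Q d]|.
Proof.
rewrite -[RHS]sum1dep_card big_mkcondr (set_partition_big _ faces_partition) /=.
by apply: eq_bigr => f _; rewrite -sum1dep_card big_mkcondr.
Qed.

(** A dart is real, leaves a false vertex or enters one, exclusively, as false vertices are never
    adjacent. On a face, [phi] maps the entering darts bijectively onto the leaving ones, whence the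
    factor 2. *)
Lemma face_nreal_nfalse f : f \in faces -> #|f| = nreal f + 2 * nfalse f.
Proof.
move=> fF; have fphi := face_phi fF.
have sfD d : d \in f -> d \in D by move=> df; rewrite (facesP fF df).
have -> : 2 * nfalse f = nfalse f + #|[set d in f | is_false d.2]|.
  rewrite mul2n -addnn; congr addn.
  rewrite -[RHS](card_imset _ phi_inj); apply: eq_card => d.
  apply/idP/imsetP => [|[q]]; last first.
    rewrite !inE => /andP[qf q2] ->.
    by rewrite fphi //= phiE //= sfD.
  rewrite inE => /andP[df d1].
  have [q qf Eq] : exists2 q, q \in f & d = phi q.
    exists (finv phi d); last by rewrite f_finv //; exact: phi_inj.
    by rewrite (facesP fF df).1 inE fconnect_finv.
  exists q => //; rewrite inE qf; move: d1.
  by rewrite Eq phiE ?sfD.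
rewrite /nreal /nfalse -(cardsID [set d | real_dart d]) -setIdE; congr addn.
rewrite -(cardsID [set d | is_false d.1] (f :\: _)); congr addn;
  apply: eq_card => d; rewrite !inE /real_dart.
  by case: (d \in f); case: (is_false d.1); rewrite ?andbF.
case df: (d \in f); rewrite ?andbF //= andbT.
have := sfD _ df; rewrite inE.
by case: d {df} => [[x|k] [y|l]].
Qed.

Lemma iter_face f d : f \in faces -> d \in f -> iter #|f| phi d = d.
Proof.
move=> fF df; rewrite (facesP fF df).1.
have -> : #|face d| = order phi d by apply: eq_card => x; rewrite inE.
by rewrite iter_order //; exact: phi_inj.
Qed.

(** * Digons and the components they fill *)

Lemma phi_neq d : d \in D -> phi d != d.
Proof.
move=> dD; apply: contraTneq dD => E; rewrite inE.
case Dd: (e d.1 d.2) => //; have := E; rewrite phiE ?inE //.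
by case: d Dd {E} => u v /= uv [E _]; rewrite E padjI in uv.
Qed.

Lemma face_ge2 f : f \in faces -> 2 <= #|f|.
Proof.
case/imsetP=> d dD ->.
have <- : #|[set d; phi d]| = 2 by rewrite cards2 eq_sym phi_neq.
by apply/subset_leq_card/subsetP => q /set2P[->|->]; rewrite inE ?fconnect1.
Qed.

(** Going round the digon shows that the rotation at [d.1] fixes [d.2]. As this rotation is a single
    cycle on the neighbours, [d.2] is the only one. *)
Lemma digon_leaf f d w : f \in faces -> d \in f -> #|f| = 2 -> e d.1 w -> w = d.2.
Proof.
move=> fF df f2; have := iter_face fF df; rewrite f2 /=.
have dD := (facesP fF df).2.
rewrite [phi (phi d)]phiE ?phi_darts // phiE //=.
case: d {df} dD => u v; rewrite inE /= => uv [Eu]; rewrite Eu => Ev uw.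
have [_ _ /(_ _ _ _ uv uw)[n <-]] := rotP.
by elim: n => //= n ->.
Qed.

(** Every vertex on a digon is a leaf, while a false vertex has four neighbours. *)
Lemma digon_nfalse f : f \in faces -> #|f| = 2 -> nfalse f = 0.
Proof.
move=> fF f2; apply: eq_card0 => d; rewrite !inE; apply/negP => /andP[df].
have leaf w := digon_leaf (w := w) fF df f2.
case: d df leaf => [[//|k] v] _ /= leaf _.
have [z1 z1k _] := mem_cr_nbhd_other k (ka k) (ka k).
have [z2 z2k] := mem_cr_nbhd_other k z1 z1.
by case/set2P; left; have := leaf (inl z1) z1k; rewrite -(leaf (inl z2) z2k) => -[].
Qed.

Definition component u := [set w | connect e u w].

Lemma digon_support f d : f \in faces -> d \in f -> #|f| = 2 ->
  component d.1 = [set d.1; d.2].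
Proof.
move=> fF df f2; have pf := face_phi fF df.
have dD := (facesP fF df).2.
have leaf1 w := digon_leaf (w := w) fF df f2.
have leaf2 w := digon_leaf (w := w) fF pf f2.
have := iter_face fF df; rewrite f2 /=.
rewrite [phi (phi d)]phiE ?phi_darts // phiE //=.
rewrite phiE // in leaf2; move: leaf1 leaf2.
case: d {df pf} dD => u v; rewrite inE /= => uv leaf1 leaf2 [Eu _].
apply/setP => w; rewrite !inE; apply/idP/idP; last first.
  by case/orP=> /eqP-> //; apply: connect1.
case/connectP=> p; elim/last_ind: p w => [w _ -> |p z IH w]; first by rewrite eqxx.
rewrite rcons_path last_rcons => /andP[/IH/(_ erefl) + +] ->.
by case/orP=> /eqP-> => [/leaf1|/leaf2] ->; rewrite ?Eu eqxx ?orbT.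
Qed.

Definition components := [set component u | u : V + K].
Definition nontriv_components := [set component u | u in [set u | [exists w, e u w]]].
Definition digons := [set f in faces | #|f| == 2].

(** Two digons with the same vertices share a dart: a common vertex is a leaf, so its only outgoing
    dart lies on both. *)
Lemma digon_component_inj :
  {in digons &, injective (fun f : {set _} => [set d.1 | d in f])}.
Proof.
move=> f g; rewrite !inE => /andP[fF /eqP f2] /andP[gF /eqP g2] /= E.
have /imsetP[d dD defF] := fF.
have df : d \in f by rewrite defF face_refl.
have : d.1 \in [set d.1 | d in f] by apply: imset_f.
rewrite E => /imsetP[q qg Eq].
have qD := (facesP gF qg).2.
suff -> : f = g by [].
rewrite (facesP fF df).1 (facesP gF qg).1; congr face.
rewrite [d]surjective_pairing [q]surjective_pairing Eq; congr pair.
by symmetry; apply: (digon_leaf fF df f2); rewrite Eq; rewrite inE in qD.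
Qed.

Lemma digon_component f d : f \in faces -> d \in f -> #|f| = 2 ->
  [set d.1 | d in f] = component d.1.
Proof.
move=> fF df f2; rewrite (digon_support fF df f2).
have pf := face_phi fF df; have dD := (facesP fF df).2.
have {1}-> : f = [set d; phi d].
  apply/esym/eqP; rewrite eqEcard cards2 eq_sym phi_neq // f2 andbT.
  by apply/subsetP => q /set2P[->|->].
by rewrite imsetU1 imset_set1 phiE.
Qed.

Lemma digons_sub_nontriv_components :
  [set [set d.1 | d in f] | f : {set (V + K) * (V + K)} in digons]
    \subset nontriv_components.
Proof.
apply/subsetP => A /imsetP[f]; rewrite inE => /andP[fF /eqP f2] ->.
have /imsetP[d dD defF] := fF.
have df : d \in f by rewrite defF face_refl.
rewrite (digon_component fF df f2); apply: imset_f.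
by rewrite inE; apply/existsP; exists d.2; rewrite inE in dD.
Qed.

Lemma sum_digons : \sum_(f in faces) (#|f| == 2 : nat) = #|digons|.
Proof.
by rewrite -sum1dep_card [RHS]big_mkcondr; apply: eq_bigr => f _; case: eqP.
Qed.

Lemma card_digons_le : #|digons| <= #|nontriv_components|.
Proof.
rewrite -(card_in_imset digon_component_inj).
by rewrite subset_leq_card ?digons_sub_nontriv_components.
Qed.

(** The component of a crossing contains a false vertex, so it is not filled by a digon. *)
Lemma card_digons_lt : 0 < #|K| -> #|digons| < #|nontriv_components|.
Proof.
case/card_gt0P => k K0; rewrite -(card_in_imset digon_component_inj).
apply/proper_card/properP; split; first exact: digons_sub_nontriv_components.
have [z zk _] := mem_cr_nbhd_other k (ka k) (ka k).
exists (component (inr k)).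
  by apply: imset_f; rewrite inE; apply/existsP; exists (inl z).
apply/imsetP => -[f]; rewrite inE => /andP[fF /eqP f2] E.
have : inr k \in component (inr k) by rewrite inE.
rewrite E => /imsetP[d df Ed].
have := digon_nfalse fF f2; apply/eqP; rewrite -lt0n; apply/card_gt0P.
by exists d; rewrite inE df -Ed.
Qed.

Lemma nontriv_components_le : #|nontriv_components| <= #|components|.
Proof.
by apply/subset_leq_card/subsetP => _ /imsetP[u _ ->]; apply: imset_f.
Qed.

Lemma nontriv_components_gt0 : 0 < #|D| -> 0 < #|nontriv_components|.
Proof.
case/card_gt0P => d; rewrite inE => dD; apply/card_gt0P.
by exists (component d.1); apply: imset_f; rewrite inE; apply/existsP; exists d.2.
Qed.

Lemma sum_nfalse : \sum_(f in faces) nfalse f = 4 * #|K|.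
Proof. by rewrite -card_false_darts -sum_faces. Qed.

Lemma sum_nreal : \sum_(f in faces) nreal f + 4 * #|K| = 2 * nedges adj.
Proof. by rewrite -card_real_darts -sum_faces. Qed.

Lemma card_darts : #|D| = 2 * nedges adj + 4 * #|K|.
Proof.
rewrite (card_partition faces_partition).
rewrite (eq_bigr (fun f => nreal f + 2 * nfalse f)) => [|f]; last first.
  exact: face_nreal_nfalse.
by rewrite big_split -big_distrr /= sum_nfalse -sum_nreal -addnA -mulnDl mulnA.
Qed.

(** * Euler's formula and the discharging *)

Hypothesis planar : genus0 adj ka kb kc kd rot.

Lemma euler : 2 * #|V| + 2 * #|K| + 2 * #|faces| =
  #|D| + 2 * #|components| + 2 * #|nontriv_components|.
Proof. by move: planar; rewrite /genus0 card_sum mulnDr. Qed.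

(** The face lengths, plus 1 for each digon, sum to at least [3 * #|faces|]. The constant is 5
    rather than 6 because of digons: a single edge attains equality. *)
Lemma nedges_drawing_le : 0 < #|D| -> nedges adj + 5 <= 3 * #|V| + #|K|.
Proof.
move=> D0; have := nontriv_components_gt0 D0.
have := card_digons_le; have := nontriv_components_le.
have : \sum_(f in faces) 3 <= \sum_(f in faces) (#|f| + (#|f| == 2)).
  by apply: leq_sum => f fF; have := face_ge2 fF; case: eqP; lia.
rewrite sum_nat_const sumnD sum_digons -(card_partition faces_partition).
have := euler; have := card_darts.
move: #|V| #|K| #|faces| #|digons| #|nontriv_components| #|components| #|D|.
move: (nedges adj); lia.
Qed.

Definition false_triangle f := (nreal f == 1) && (nfalse f == 1).

(** The length is 1 + 2 = 3. After the only real dart, from [x] to [y], the walk must go to a false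
    vertex and from there straight back to [x]. *)
Lemma false_triangle_vertex f x y : f \in faces -> false_triangle f ->
  (inl x, inl y) \in f ->
  exists k, [/\ rot (inr k) (inl y) = inl x, x \in N k & y \in N k].
Proof.
move=> fF /andP[/eqP r1 /eqP t1] df; set d := (_, _) in df.
have dD := (facesP fF df).2; have pf := face_phi fF df.
have := iter_face fF df; rewrite (face_nreal_nfalse fF) r1 t1 /=.
have := pf; have pD : phi d \in D by rewrite phi_darts.
rewrite [phi (phi (phi d))]phiE ?phi_darts // [phi (phi d)]phiE //=.
have := phi_neq dD; have := pD.
rewrite phiE //=; case E: (rot (inl y) (inl x)) => [z|k] qD qd qf.
  have : #|[set d; (inl y, inl z)]| <= nreal f.
    apply/subset_leq_card/subsetP => q /set2P[]->; rewrite inE ?df ?qf //.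
  by rewrite r1 cards2 eq_sym qd.
move=> [E1 _]; exists k; split=> //; last by rewrite inE in qD.
have [rotD _ _] := rotP.
have := rotD (inr k) (inl y); rewrite E1 /=; apply.
by rewrite inE in qD.
Qed.

Hypothesis near_indep : forall k1 k2, k1 != k2 -> #|N k1 :&: N k2| <= 1.

(** The two false vertices share the neighbours [x] and [y], hence coincide. The rotation there
    would then exchange [x] and [y], and its cycle would miss the other two neighbours. *)
Lemma false_triangle_swap f g x y : f \in faces -> false_triangle f ->
  g \in faces -> false_triangle g ->
  (inl x, inl y) \in f -> (inl y, inl x) \notin g.
Proof.
move=> fF fT gF gT df; apply/negP => dg.
have [k [kyx xk yk]] := false_triangle_vertex fF fT df.
have [l [lxy yl xl]] := false_triangle_vertex gF gT dg.
have xy : x != y.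
  have := (facesP fF df).2; rewrite inE /=.
  by apply: contraTneq => ->; rewrite adjI.
have Ekl : k = l.
  apply/eqP; apply: contraT => /near_indep; rewrite leqNgt => /negP[].
  have <- : #|[set x; y]| = 2 by rewrite cards2 xy.
  by apply/subset_leq_card/subsetP => z /set2P[]->; rewrite in_setI ?xk ?yk ?xl ?yl.
rewrite -{l}Ekl in lxy yl xl.
have [z zk zxy] := mem_cr_nbhd_other k x y.
have [_ _ /(_ (inr k) (inl x) (inl z) xk zk)[n Ez]] := rotP.
(* The orbit of [x] stays within [x] and [y], yet it has to reach [z]. *)
suff: (iter n (rot (inr k)) (inl x) == inl x) ||
      (iter n (rot (inr k)) (inl x) == inl y).
  rewrite Ez => zE; move: zxy; rewrite !inE => /negP[].
  by case/orP: zE => /eqP[->]; rewrite eqxx ?orbT.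
elim: n {Ez} => [|n /= /orP[]/eqP->]; first by rewrite eqxx.
  by rewrite lxy eqxx orbT.
by rewrite kyx eqxx.
Qed.

(** The discharging rule: each false triangle sends its unique real dart to the reversed dart, which
    lies on a face of the other kind. Reversal is injective. *)
Lemma false_triangles_le :
  \sum_(f in faces) (false_triangle f : nat) <=
  \sum_(f in faces) ~~ false_triangle f * nreal f.
Proof.
(* Both sides become counts of real darts, sorted by whether their face is a false triangle. *)
pose A (b : bool) d := real_dart d && (false_triangle (face d) == b).
have cA b : \sum_(f in faces) (false_triangle f == b) * nreal f =
    #|[set d in D | A b d]|.
  rewrite -sum_faces; apply: eq_bigr => f fF.
  case: eqP => fT; rewrite ?mul1n ?mul0n.
    apply: eq_card => d; rewrite !inE /A; case df: (d \in f) => //=.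
    by rewrite -(facesP fF df).1 fT eqxx andbT.
  apply/esym/eq_card0 => d; rewrite !inE /A; case df: (d \in f) => //=.
  by rewrite -(facesP fF df).1 andbC; case: eqP.
rewrite (eq_bigr (fun f => (false_triangle f == true) * nreal f)); last first.
  by move=> f _; rewrite eqb_id; case: (boolP (false_triangle f)) => // /andP[/eqP-> _].
rewrite [leqRHS](eq_bigr (fun f => (false_triangle f == false) * nreal f)); last first.
  by move=> f _; rewrite eqbF_neg.
rewrite !cA -(card_imset _ (can_inj swap_pairK)) subset_leq_card //.
apply/subsetP => q /imsetP[d dA ->]; move: dA; rewrite !inE /A.
case: d => [[x|k] [y|l]] //= /andP[xy]; rewrite ?andbF // eqb_id eqbF_neg => T.
rewrite adjC crossedC xy /=; apply/negP => T'.
have dD : (inl x, inl y) \in D by rewrite inE.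
have qD : (inl y, inl x) \in D by rewrite inE padjC.
have := false_triangle_swap (imset_f _ dD) T (imset_f _ qD) T' (face_refl _).
by rewrite face_refl.
Qed.

Lemma near_indep_nedges_le : 0 < #|K| -> 5 * nedges adj + 36 <= 18 * #|V|.
Proof.
move=> K0; have := card_digons_lt K0; have := nontriv_components_le; have := euler.
have := card_darts; have := sum_nreal; have := sum_nfalse.
have := false_triangles_le.
(* The inequality holds face by face: with equality 36 = 13 + 22 + 1 on false triangles, 36 + 2 = 26
   + 12 on digons, and otherwise because 12 r + 22 t >= 36. The weights 13 and 22 make the number of
   crossings cancel against Euler's formula. *)
have : #|faces| * 36 + \sum_(f in faces) ~~ false_triangle f * nreal f <=
    13 * \sum_(f in faces) nreal f + 22 * \sum_(f in faces) nfalse f +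
    \sum_(f in faces) false_triangle f + 12 * #|digons|.
  rewrite -sum_digons -sum_nat_const -!sumnMr -!sumnD; apply: leq_sum => f fF.
  have := face_ge2 fF; have := digon_nfalse fF.
  rewrite (face_nreal_nfalse fF) /false_triangle.
  case: (nreal f) (nfalse f) => [|[|[|r]]] [|[|t]] //=; lia.
move: #|V| #|K| #|faces| #|digons| #|nontriv_components| #|components| #|D|.
move: (nedges adj).
by do 4 move: (\sum_(f in faces) _); lia.
Qed.

End Drawing.

(** * Sharpness: the crossing bound in class C_0 and the cuboctahedron *)

Lemma disjoint_crossings_le (V : finType) (adj : rel V) (K : finType)
    (ka kb kc kd : K -> V) :
  valid_crossings adj ka kb kc kd ->
  (forall k1 k2, k1 != k2 ->
     #|cr_nbhd ka kb kc kd k1 :&: cr_nbhd ka kb kc kd k2| <= 0) ->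
  4 * #|K| <= #|V|.
Proof.
move=> valid disj; pose N := cr_nbhd ka kb kc kd.
have trivN : trivIset [set N k | k : K].
  apply/trivIsetP => _ _ /imsetP[k _ ->] /imsetP[l _ ->] kl.
  rewrite -setI_eq0 -cards_eq0 -leqn0 disj //.
  by apply: contraNneq kl => ->.
have N_inj : injective N.
  move=> k l E; apply/eqP; apply: contraT => /disj.
  by rewrite -/(N l) -/(N k) E setIid (card_cr_nbhd valid).
apply: leq_trans (max_card (mem (cover [set N k | k : K]))).
rewrite -(eqP trivN) big_imset /=; last by move=> ? ? _ _; apply: N_inj.
rewrite (eq_bigr (fun=> 4)) ?sum_nat_const 1?mulnC // => k _.
exact: card_cr_nbhd valid k.
Qed.

(* Nodes 0 .. 11 are the vertices of the cuboctahedron and 12 + k is the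
   crossing of the two diagonals of its k-th square.  Row u lists the
   neighbours of node u in the cyclic order of the drawing. *)
Definition wheel (u : nat) : seq nat := nth [::]
  [:: [:: 1; 12; 2; 5; 13; 4];
      [:: 0; 4; 14; 6; 3; 12];
      [:: 0; 12; 3; 7; 16; 5];
      [:: 1; 6; 15; 7; 2; 12];
      [:: 0; 13; 8; 9; 14; 1];
      [:: 0; 2; 16; 10; 8; 13];
      [:: 1; 14; 9; 11; 15; 3];
      [:: 2; 3; 15; 11; 10; 16];
      [:: 4; 13; 5; 10; 17; 9];
      [:: 4; 8; 17; 11; 6; 14];
      [:: 5; 16; 7; 11; 17; 8];
      [:: 6; 9; 17; 10; 7; 15];
      [:: 0; 1; 3; 2];
      [:: 0; 5; 8; 4];
      [:: 1; 4; 9; 6];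
      [:: 3; 6; 11; 7];
      [:: 2; 7; 10; 5];
      [:: 8; 10; 11; 9]] u.

(** Every edge of the cuboctahedron lies on a square, so sharing a square describes the sides and
    the diagonals at once. *)
Definition same_square (m n : nat) : bool :=
  has (fun k => (m \in wheel (12 + k)) && (n \in wheel (12 + k))) (iota 0 6).

Definition cuboct_adj : rel 'I_12 := fun x y => (x != y) && same_square x y.

(** The remainder only supplies the ordinal bound, the entries being below 12 already. Corners are
    in cyclic order, so the diagonals join 0 to 2 and 1 to 3. *)
Definition corner (i : nat) (k : 'I_6) : 'I_12 :=
  Ordinal (ltn_pmod (nth 0 (wheel (12 + k)) i) (isT : 0 < 12)).

Local Notation ka := (corner 0).
Local Notation kb := (corner 2).
Local Notation kc := (corner 1).
Local Notation kd := (corner 3).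
Local Notation padjW := (padj cuboct_adj ka kb kc kd).

Definition code (u : 'I_12 + 'I_6) : nat :=
  match u with inl x => x | inr k => 12 + k end.

Definition node (m : nat) : 'I_12 + 'I_6 :=
  if m < 12 then inl (Ordinal (ltn_pmod m (isT : 0 < 12)))
  else inr (Ordinal (ltn_pmod (m - 12) (isT : 0 < 6))).

Definition turn (u v : 'I_12 + 'I_6) : 'I_12 + 'I_6 :=
  node (next (wheel (code u)) (code v)).

(** * Reduction of the example to computations on node codes *)

Lemma iota_all n (P : pred nat) :
  all P (iota 0 n) -> forall i, i < n -> P i.
Proof. by move/allP => H i i_n; apply: H; rewrite mem_iota. Qed.

Lemma iota_all2 n1 n2 (P : nat -> pred nat) :
  all (fun i => all (P i) (iota 0 n2)) (iota 0 n1) ->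
  forall i j, i < n1 -> j < n2 -> P i j.
Proof. by move=> H i j /(iota_all H) Hi; apply: (iota_all Hi). Qed.

Lemma code_lt u : code u < 18.
Proof. by case: u => [[m lt_m]|[m lt_m]] /=; lia. Qed.

Lemma codeK : cancel code node.
Proof.
rewrite /node => -[x|k] /=.
  by rewrite ltn_ord; congr inl; apply: val_inj; rewrite /= modn_small.
by congr inr; apply: val_inj; rewrite /= addKn modn_small.
Qed.

Lemma nodeK m : m < 18 -> code (node m) = m.
Proof.
rewrite /node => lt_m; case: ltnP => /= ge_m; first exact: modn_small.
by rewrite modn_small; lia.
Qed.

Lemma crossedE (x y : 'I_12) : crossed ka kb kc kd x y =
  has (fun k => ((ka k == x) && (kb k == y) || (ka k == y) && (kb k == x)) ||
                ((kc k == x) && (kd k == y) || (kc k == y) && (kd k == x)))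
      (enum 'I_6).
Proof.
apply/existsP/hasP => [[[k b] /=]|[k _]].
  rewrite /cr_edge /= => H; exists k; first by rewrite mem_enum.
  by case: b H => /=; rewrite set2_eqE => ->; rewrite ?orbT.
case/orP=> H; [exists (k, true)|exists (k, false)];
by rewrite /cr_edge /= set2_eqE.
Qed.

Lemma corner_mod i (k : 'I_6) :
  nth 0 (wheel (12 + k)) i %% 12 = nth 0 (wheel (12 + k)) i.
Proof.
rewrite modn_small //; case: (ltnP i 4) => [|i4].
  case: k => k /=; move: k i.
  by apply: (@iota_all2 6 4 (fun k i => nth 0 (wheel (12 + k)) i < 12)).
rewrite nth_default //; apply: leq_trans i4.
by case: k => k /=; move: k; apply: (@iota_all 6 (fun k => size (wheel (12 + k)) <= 4)).
Qed.

Definition crossed_code (m n : nat) : bool :=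
  has (fun k => let c i := nth 0 (wheel (12 + k)) i in
    [|| (c 0 == m) && (c 2 == n), (c 0 == n) && (c 2 == m),
        (c 1 == m) && (c 3 == n) | (c 1 == n) && (c 3 == m)]) (iota 0 6).

Lemma crossed_codeE (x y : 'I_12) : crossed ka kb kc kd x y = crossed_code x y.
Proof.
rewrite crossedE /crossed_code -val_enum_ord has_map; apply: eq_has => k.
by rewrite -!val_eqE /= !corner_mod !orbA.
Qed.

Lemma corner_nbhd x k : (x \in cr_nbhd ka kb kc kd k) = (val x \in wheel (12 + k)).
Proof.
rewrite !inE -!val_eqE /= !corner_mod -!orbA.
case: k x => k k6 [x x12] /=; apply/eqP; move: k x k6 x12.
exact: iota_all2.
Qed.

(** The link between the table and the planarization: from here on, facts about darts can be checked
    by running through the rows. *)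
Lemma padjWE u v : padjW u v = (code v \in wheel (code u)).
Proof.
case: u v => [x|k] [y|l]; rewrite /= ?corner_nbhd //.
- rewrite crossed_codeE /cuboct_adj -val_eqE /=; apply/eqP.
  by case: x y => [x x12] [y y12] /=; move: x y x12 y12; apply: iota_all2.
- by apply/eqP; case: x l => [x x12] [l l6] /=; move: x l x12 l6; apply: iota_all2.
- apply/esym/negbTE; case: k l => [k k6] [l l6] /=.
  by move: k l k6 l6; apply: iota_all2.
Qed.

Lemma node_all (P : pred nat) : all P (iota 0 18) -> forall u, P (code u).
Proof. by move=> H u; apply: (iota_all H); rewrite code_lt. Qed.

Lemma wheel_all (P : nat -> pred nat) :
  all (fun m => all (P m) (wheel m)) (iota 0 18) ->
  forall u v, padjW u v -> P (code u) (code v).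
Proof. by move=> /node_all H u v; rewrite padjWE; apply: (allP (H u)). Qed.

Lemma wheel_lt u m : m \in wheel (code u) -> m < 18.
Proof.
apply: (allP (node_all (P := fun m => all (fun n => n < 18) (wheel m)) _ u)).
by [].
Qed.

Lemma code_turn u v : padjW u v -> code (turn u v) = next (wheel (code u)) (code v).
Proof.
by rewrite padjWE => uv; rewrite nodeK // (@wheel_lt u) // mem_next.
Qed.

Lemma turn_rotation : rotation_system cuboct_adj ka kb kc kd turn.
Proof.
split=> [u v uv|u v w uv uw E|u v w].
- by rewrite padjWE code_turn // mem_next -padjWE.
- apply: (can_inj codeK); move: (congr1 code E); rewrite !code_turn // => E'.
  have uniq_u : uniq (wheel (code u)).
    by apply: (node_all (P := fun m => uniq (wheel m))).
  by rewrite -(prev_next uniq_u (code v)) E' prev_next.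
- move=> uv uw.
  have iter_turn n : code (iter n (turn u) v) = iter n (next (wheel (code u))) (code v)
              /\ padjW u (iter n (turn u) v).
    elim: n => //= n [IH IH']; rewrite code_turn // IH; split=> //.
    by rewrite padjWE code_turn // mem_next -padjWE.
  (* No row is longer than 6, so fewer than 6 turns reach any neighbour. *)
  have := wheel_all (P := fun m n => all (fun p =>
      has (fun i => iter i (next (wheel m)) n == p) (iota 0 6)) (wheel m)) isT uv.
  rewrite padjWE in uw; move/allP/(_ _ uw)/hasP => [i _ /eqP Ei].
  by exists i; apply: (can_inj codeK); rewrite (iter_turn i).1.
Qed.

Lemma turn_alternating : alternating ka kb kc kd turn.
Proof.
move=> k; split; rewrite -(can_eq codeK) code_turn /= ?inE ?eqxx ?orbT //;
  rewrite !corner_mod; case: k => k /=; move: k; exact: iota_all.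
Qed.

Lemma cuboct_adjC : symmetric cuboct_adj.
Proof.
move=> x y; rewrite /cuboct_adj eq_sym; congr andb.
by apply: eq_has => k; rewrite andbC.
Qed.

Lemma cuboct_adjI : irreflexive cuboct_adj.
Proof. by move=> x; rewrite /cuboct_adj eqxx. Qed.

Lemma nedges_cuboct : nedges cuboct_adj = 36.
Proof.
apply: double_inj; rewrite -!mul2n -(card_darts_edge_set cuboct_adjC cuboct_adjI).
rewrite -sum1dep_card big_mkcond.
rewrite -(pair_big predT predT (fun x y => if cuboct_adj x y then 1 else 0)) /=.
(* Summing degrees over naturals gives a closed term that evaluates to 72, twice the number of
   edges. *)
pose deg m := \sum_(0 <= n < 12) ((m != n) && same_square m n).
rewrite (eq_bigr (fun x : 'I_12 => deg x)).
  rewrite -(big_mkord xpredT deg) /deg.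
  by rewrite unlock.
move=> x _; rewrite /deg big_mkord; apply: eq_bigr => y _.
by rewrite /cuboct_adj -val_eqE; case: (_ && _).
Qed.

Lemma cuboct_valid : valid_crossings cuboct_adj ka kb kc kd.
Proof.
split=> [k|[k b] [l c] /eqP E].
  rewrite -(map_inj_uniq val_inj) /cuboct_adj -!val_eqE /= !corner_mod.
  by case: k => k k6 /=; split; move: k k6; apply: iota_all.
apply/eqP; move: E; rewrite /cr_edge xpair_eqE /= -[k == l]val_eqE /=.
case: b c => [] []; rewrite set2_eqE -!val_eqE /= !corner_mod; apply/implyP;
  by case: k l => [k k6] [l l6] /=; move: k l k6 l6; apply: iota_all2.
Qed.

Lemma cuboct_near_indep k1 k2 : k1 != k2 ->
  #|cr_nbhd ka kb kc kd k1 :&: cr_nbhd ka kb kc kd k2| <= 1.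
Proof.
have -> : #|cr_nbhd ka kb kc kd k1 :&: cr_nbhd ka kb kc kd k2| =
    \sum_(0 <= m < 12) ((m \in wheel (12 + k1)) && (m \in wheel (12 + k2))).
  rewrite big_mkord -sum1_card big_mkcond; apply: eq_bigr => x _.
  by rewrite in_setI !corner_nbhd; case: (_ && _).
rewrite -val_eqE; case: k1 k2 => [k k6] [l l6] /=; apply/implyP.
by rewrite unlock; move: k l k6 l6; apply: iota_all2.
Qed.

(** * Faces, connectedness and genus of the example *)

Local Notation DW := (darts cuboct_adj ka kb kc kd).
Local Notation phiW := (face_map cuboct_adj ka kb kc kd turn).

(** With [p] the turn at [v] from [u], it suffices that the turn at [p] from [v] is [u] and the turn
    at [u] from [p] is [v]; both are read off the table. *)
Lemma cuboct_face_triangle d : d \in DW -> phiW (phiW (phiW d)) = d.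
Proof.
have rotW := turn_rotation; have adjWC := cuboct_adjC.
move=> dD.
have D1 : phiW d \in DW by rewrite phi_darts.
have D2 : phiW (phiW d) \in DW by rewrite phi_darts.
rewrite [LHS]phiE //; move: D2; rewrite [phiW (phiW d)]phiE //.
move: D1; rewrite phiE //=; case: d dD => u v; rewrite !inE /= => uv vw wx.
have vu : padjW v u by rewrite padjC.
have wv : padjW (turn v u) v by rewrite padjC.
pose P m n := let p := next (wheel n) m in
  (next (wheel p) n == m) && (next (wheel m) p == n).
have /andP[/eqP E1 /eqP E2] : P (code u) (code v) by apply: wheel_all uv.
have wvu : turn (turn v u) v = u by apply: (can_inj codeK); rewrite !code_turn.
rewrite wvu in wx *; congr pair.
by apply: (can_inj codeK); rewrite !code_turn // padjC.
Qed.

(** [phiW] has no fixed dart and its cube is the identity on darts, so each orbit has exactly 3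
    elements. *)
Lemma cuboct_nfaces : 3 * nfaces cuboct_adj ka kb kc kd turn = #|DW|.
Proof.
have rotW := turn_rotation; have adjWC := cuboct_adjC.
rewrite (card_uniform_partition (n := 3) _ (faces_partition adjWC rotW)) 1?mulnC //.
move=> _ /imsetP[d dD ->].
have neq := phi_neq cuboct_adjI turn.
have D1 : phiW d \in DW by rewrite phi_darts.
have D2 : phiW (phiW d) \in DW by rewrite phi_darts.
have phi3 := cuboct_face_triangle dD.
have -> : #|face cuboct_adj ka kb kc kd turn d| = order phiW d.
  by apply: eq_card => x; rewrite inE.
apply: (order_cycle (p := [:: d; phiW d; phiW (phiW d)])); rewrite ?mem_head //=.
  by rewrite phi3 !eqxx.
have := neq _ _ _ _ _ D2; rewrite phi3 => n3.
by rewrite !inE negb_or n3 [d == phiW d]eq_sym neq //= eq_sym neq.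
Qed.

(** The first entry of each row but row 0 is a smaller node, so following first entries descends to
    node 0. *)
Lemma cuboct_connected u : connect padjW (node 0) u.
Proof.
have [m] := ubnP (code u); elim: m u => // m IH u; rewrite ltnS => um.
have [u0|u0] := eqVneq (code u) 0; first by rewrite -[u]codeK u0.
have := node_all (P := fun m => (m != 0) ==>
  (head 0 (wheel m) < m) && (head 0 (wheel m) \in wheel m)) isT u.
rewrite u0 /= => /andP[lt_u in_u].
have lt18 := wheel_lt in_u.
apply: (@connect_trans _ _ (node (head 0 (wheel (code u))))).
  by apply: IH; rewrite nodeK //; apply: leq_trans um.
by apply: connect1; rewrite padjC ?padjWE ?nodeK //; apply: cuboct_adjC.
Qed.

(** With 18 nodes, 32 faces, 96 darts and one component, the formula reads 36 + 64 = 96 + 2 + 2. *)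
Lemma cuboct_genus0 : genus0 cuboct_adj ka kb kc kd turn.
Proof.
have D96 : #|DW| = 96.
  rewrite (card_darts cuboct_adjC cuboct_adjI cuboct_valid turn_rotation).
  by rewrite nedges_cuboct card_ord.
have F32 : nfaces cuboct_adj ka kb kc kd turn = 32.
  by have := cuboct_nfaces; rewrite D96; lia.
have c1 : #|components cuboct_adj ka kb kc kd| <= 1.
  rewrite -[leqRHS](cards1 (component cuboct_adj ka kb kc kd (node 0))).
  apply/subset_leq_card/subsetP => _ /imsetP[u _ ->]; apply/set1P.
  apply/setP => v; rewrite !inE.
  have sym : connect_sym padjW.
    by apply: sym_connect_sym; apply: padjC; exact: cuboct_adjC.
  by rewrite (same_connect sym (cuboct_connected u)).
have n0 : 0 < #|nontriv_components cuboct_adj ka kb kc kd|.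
  by apply: nontriv_components_gt0; rewrite D96.
have le := nontriv_components_le cuboct_adj ka kb kc kd.
rewrite /genus0 D96 F32 card_sum !card_ord.
rewrite -[ncomp _ _ _ _ _]/#|components cuboct_adj ka kb kc kd|.
rewrite -[ncomp_nontriv _ _ _ _ _]/#|nontriv_components cuboct_adj ka kb kc kd|.
have -> : #|components cuboct_adj ka kb kc kd| = 1.
  by apply/eqP; rewrite eqn_leq c1 (leq_trans n0).
suff -> : #|nontriv_components cuboct_adj ka kb kc kd| = 1 by [].
by apply/eqP; rewrite eqn_leq n0 (leq_trans le).
Qed.

Lemma cuboct_not_C0 : ~ classC0 cuboct_adj.
Proof.
case=> K [a [b [c [d [[valid [rot [rotP _ planar]]] disj]]]]].
have K12 := disjoint_crossings_le valid disj.
have := nedges_drawing_le cuboct_adjC cuboct_adjI valid rotP planar.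
rewrite (card_darts cuboct_adjC cuboct_adjI valid rotP).
rewrite nedges_cuboct; move: K12; rewrite card_ord => K12 /(_ isT).
by move: #|K| K12; lia.
Qed.

(* |E| <= 3.6|V| - 7.2  <=>  5|E| + 36 <= 18|V| *)
Theorem theorem20 :
  (forall (V : finType) (adj : rel V),
     symmetric adj -> irreflexive adj -> classC1 adj ->
     5 * nedges adj + 36 <= 18 * #|V|) /\
  (exists (V : finType) (adj : rel V),
     [/\ symmetric adj, irreflexive adj, classC1 adj &
         5 * nedges adj + 36 = 18 * #|V|]).
Proof.
split=> [V adj adjC adjI [notC0]|].
  case=> K [ka [kb [kc [kd [draw indep]]]]].
  have [valid [rot [rotP _ planar]]] := draw.
  apply: (near_indep_nedges_le adjC adjI valid rotP planar indep).
  (* A drawing without crossings would satisfy the condition for C_0 vacuously. *)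
  rewrite lt0n; apply/negP => /eqP K0; apply: notC0.
  exists K, ka, kb, kc, kd; split=> // k.
  by have := fintype0 k K0.
exists 'I_12, cuboct_adj; split; last by rewrite nedges_cuboct card_ord.
- exact: cuboct_adjC.
- exact: cuboct_adjI.
split; first exact: cuboct_not_C0.
exists 'I_6, (corner 0), (corner 2), (corner 1), (corner 3); split.
  split; first exact: cuboct_valid.
  exists turn; split; [exact: turn_rotation|exact: turn_alternating|].
  exact: cuboct_genus0.
exact: cuboct_near_indep.
Qed.
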